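(* Let $R$ be any ring, let $(\mathcal{L},\mathcal{A})$ be a complete duality pair over $R$, let $\mathcal{GP}$ be the class of Gorenstein $(\mathcal{L},\mathcal{A})$-projective left $R$-modules and let $\mathcal{P}$ be the class of projective left $R$-modules. The following conditions are equivalent. (1) $(\mathcal{GP},\mathcal{L})$ is a strong left Frobenius pair (in $R$-Mod). (2) $(\mathcal{GP},\mathcal{L})$ is a left Frobenius pair (in $R$-Mod). (3) $\mathcal{L}=\mathcal{P}$. In this case (when these equivalent conditions hold), $R$ is a left perfect ring, i.e. every flat left $R$-module is projective.
   Context: $R$ is an associative ring with identity; modules are left $R$-modules unless stated otherwise. For a module $M$, $M^+=\mathrm{Hom}_{\mathbb{Z}}(M,\mathbb{Q}/\mathbb{Z})$ is its character module (on the opposite side). Duality pairs: a duality pair over $R$ is a pair $(\mathcal{L},\mathcal{A})$, with $\mathcal{L}$ a class of left (resp. right) $R$-modules and $\mathcal{A}$ a class of right (resp. left) $R$-modules, such that $L\in\mathcal{L}$ if and only if $L^+\in\mathcal{A}$, and $\mathcal{A}$ is closed under direct summands and finite direct sums. With $\mathcal{L}$ a class of left modules, $(\mathcal{L},\mathcal{A})$ is perfect if $\mathcal{L}$ contains ${}_RR$ and is closed under coproducts and extensions. $(\mathcal{L},\mathcal{A})$ is complete if it is a perfect duality pair and $(\mathcal{A},\mathcal{L})$ is also a duality pair. Classes of modules are closed under isomorphism. Here $\mathcal{L}$ consists of left modules and $\mathcal{A}$ of right modules. A sequence is $\mathrm{Hom}_R(-,\mathcal{L})$-exact if it remains exact after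 applying $\mathrm{Hom}_R(-,L)$ for every $L\in\mathcal{L}$. A left $R$-module $M$ is Gorenstein $(\mathcal{L},\mathcal{A})$-projective if there is a $\mathrm{Hom}_R(-,\mathcal{L})$-exact exact sequence $\cdots\to P_1\to P_0\to P_{-1}\to P_{-2}\to\cdots$ with each $P_i$ projective such that $M\cong\mathrm{Ker}(P_{-1}\to P_{-2})$. Frobenius pairs: let $\mathcal{X},\omega$ be classes of objects in an abelian category. $\mathcal{X}$ is left thick if it is closed under direct summands, extensions and kernels of epimorphisms (between objects of $\mathcal{X}$). $\omega$ is $\mathcal{X}$-injective if $\mathrm{Ext}^j(X,W)=0$ for all $X\in\mathcal{X}$, $W\in\omega$, $j\geq1$; it is $\mathcal{X}$-projective if $\mathrm{Ext}^j(W,X)=0$ for all such $X,W,j$. $\omega$ is a relative cogenerator in $\mathcal{X}$ if $\omega\subseteq\mathcal{X}$ and each $X\in\mathcal{X}$ admits a short exact sequence $0\to X\to W\to X'\to0$ with $W\in\omega$, $X'\in\mathcal{X}$; it is a relative generator in $\mathcal{X}$ if $\omega\subseteq\mathcal{X}$ and each $X\in\mathcal{X}$ admits a short exact sequence $0\to X'\to W\to X\to0$ with $W\in\omega$, $X'\in\mathcal{X}$. $(\mathcal{X},\omega)$ is a left Frobenius pair if $\mathcal{X}$ is left thick, $\omega$ is an $\mathcal{X}$-injective relative cogenerator in $\mathcal{X}$, and $\omega$ is closed under direct summands. It is strong if moreover $\omega$ is an $\mathcal{X}$-projective relative generator in $\mathcal{X}$. *)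

(* Defs.v *)
From HB Require Import structures.
From mathcomp Require Import all_boot all_order all_algebra.
From mathcomp Require Import boolp.
From mathcomp Require Import freeg.

Set Implicit Arguments.
Unset Strict Implicit.
Unset Printing Implicit Defensive.

Import GRing.Theory.
Local Open Scope ring_scope.
Local Open Scope quotient_scope.

(* Conventions.  A ring is a pzRingType: associative, with identity, not
   necessarily commutative, possibly zero.  A left R-module is an lmodType R;
   a right R-module is an lmodType R^c, where x . r is written
   (r : R^c) *: x. *)

Definition ratZ : zmodClosed rat :=
  GRing.ZmodClosed.clone rat (@Num.int_num_subdef rat) _.

Definition QmodZ : zmodType := {ideal_quot ratZ}.

Lemma QmodZ_eq0 (x : rat) :
  (\pi_{ideal_quot ratZ} x == 0 :> QmodZ) = (x \is a Num.int).
Proof. by rewrite -[0](raddf0 \pi_{ideal_quot ratZ}) -Quotient.idealrBE subr0. Qed.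

Section AdditiveMaps.
Variables U V : zmodType.
Implicit Types f g : {additive U -> V}.

Lemma additive_ext f g : f =1 g -> f = g.
Proof.
case: f g => [f [[f0]]] [g [[g0]]] /= /funext fg.
by case: _ / fg g0 => g0; rewrite (Prop_irrelevance f0 g0).
Qed.

HB.instance Definition _ := gen_eqMixin {additive U -> V}.
HB.instance Definition _ := gen_choiceMixin {additive U -> V}.

Definition add_additive f g : {additive U -> V} := f \+ g.
Definition opp_additive f : {additive U -> V} := \- f.
Definition zero_additive : {additive U -> V} := \0.

Fact add_additiveA : associative add_additive.
Proof. by move=> f g h; apply: additive_ext => x /=; rewrite addrA. Qed.
Fact add_additiveC : commutative add_additive.
Proof. by move=> f g; apply: additive_ext => x /=; rewrite addrC. Qed.
Fact add0_additive : left_id zero_additive add_additive.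
Proof. by move=> f; apply: additive_ext => x /=; rewrite add0r. Qed.
Fact addN_additive : left_inverse zero_additive opp_additive add_additive.
Proof. by move=> f; apply: additive_ext => x /=; rewrite addNr. Qed.

HB.instance Definition _ := GRing.isZmodule.Build {additive U -> V}
  add_additiveA add_additiveC add0_additive addN_additive.

End AdditiveMaps.

Section Precomposition.
Variables (S : pzRingType) (M : lmodType S) (V : zmodType).

Definition scale_additive (r : S) (f : {additive M -> V}) : {additive M -> V} :=
  f \o ( *:%R r).

End Precomposition.

(* The two sides need separate constructions, since (R^c)^c is not
   convertible to R. *)

Definition char_left (R : pzRingType) (M : lmodType R) : Type :=
  {additive M -> QmodZ}.

Section CharLeft.
Variables (R : pzRingType) (M : lmodType R).

HB.instance Definition _ := GRing.Zmodule.on (char_left M).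

(* (f . r) x = f (r x) *)
Definition char_left_scale (r : R^c) (f : char_left M) : char_left M :=
  scale_additive (r : R) f.

Fact char_left_scaleA a b f :
  char_left_scale a (char_left_scale b f) = char_left_scale (a * b) f.
Proof. by apply: additive_ext => x /=; rewrite scalerA. Qed.
Fact char_left_scale1 : left_id 1 char_left_scale.
Proof. by move=> f; apply: additive_ext => x /=; rewrite scale1r. Qed.
Fact char_left_scaleDr : right_distributive char_left_scale +%R.
Proof. by move=> a f g; apply: additive_ext. Qed.
Fact char_left_scaleDl f : {morph char_left_scale^~ f : a b / a + b}.
Proof. by move=> a b; apply: additive_ext => x /=; rewrite scalerDl raddfD. Qed.

HB.instance Definition _ := GRing.Zmodule_isLmodule.Build R^c (char_left M)
  char_left_scaleA char_left_scale1 char_left_scaleDr char_left_scaleDl.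

End CharLeft.

Definition char_right (R : pzRingType) (M : lmodType R^c) : Type :=
  {additive M -> QmodZ}.

Section CharRight.
Variables (R : pzRingType) (M : lmodType R^c).

HB.instance Definition _ := GRing.Zmodule.on (char_right M).

(* (r . f) x = f (x r) *)
Definition char_right_scale (r : R) (f : char_right M) : char_right M :=
  scale_additive (r : R^c) f.

Fact char_right_scaleA a b f :
  char_right_scale a (char_right_scale b f) = char_right_scale (a * b) f.
Proof. by apply: additive_ext => x /=; rewrite scalerA. Qed.
Fact char_right_scale1 : left_id 1 char_right_scale.
Proof. by move=> f; apply: additive_ext => x /=; rewrite (@scale1r R^c). Qed.
Fact char_right_scaleDr : right_distributive char_right_scale +%R.
Proof. by move=> a f g; apply: additive_ext. Qed.
Fact char_right_scaleDl f : {morph char_right_scale^~ f : a b / a + b}.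
Proof.
by move=> a b; apply: additive_ext => x /=; rewrite (@scalerDl R^c) raddfD.
Qed.

HB.instance Definition _ := GRing.Zmodule_isLmodule.Build R (char_right M)
  char_right_scaleA char_right_scale1 char_right_scaleDr char_right_scaleDl.

End CharRight.

Definition modclass (R : pzRingType) := lmodType R -> Prop.

Definition exact (A B C : zmodType) (f : A -> B) (g : B -> C) : Prop :=
  forall y : B, g y = 0 <-> exists x : A, f x = y.

Definition surj (A B : Type) (f : A -> B) : Prop :=
  forall y : B, exists x : A, f x = y.

Definition short_exact (A B C : zmodType) (f : A -> B) (g : B -> C) : Prop :=
  [/\ injective f, exact f g & surj g].

Section Closure.
Variable R : pzRingType.
Implicit Types X : modclass R.

Definition iso_closed X : Prop :=
  forall (M N : lmodType R) (f : {linear M -> N}),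
    bijective f -> X M -> X N.

(* The module structure on (M * N)%type is the direct sum. *)
Definition summand_closed X : Prop :=
  forall (M M' N : lmodType R) (f : {linear N -> (M * M')%type}),
    bijective f -> X N -> X M.

Definition extension_closed X : Prop :=
  forall (A B C : lmodType R) (f : {linear A -> B}) (g : {linear B -> C}),
    short_exact f g -> X A -> X C -> X B.

Definition epi_kernel_closed X : Prop :=
  forall (A B C : lmodType R) (f : {linear A -> B}) (g : {linear B -> C}),
    short_exact f g -> X B -> X C -> X A.

Definition is_coproduct (I : Type) (M : I -> lmodType R) (C : lmodType R)
    (inj : forall i, {linear M i -> C}) : Prop :=
  forall (N : lmodType R) (f : forall i, {linear M i -> N}),
    exists h : {linear C -> N},
      (forall i x, h (inj i x) = f i x) /\
      (forall h' : {linear C -> N},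
         (forall i x, h' (inj i x) = f i x) -> h' =1 h).

Definition coproduct_closed X : Prop :=
  forall (I : Type) (M : I -> lmodType R) (C : lmodType R)
    (inj : forall i, {linear M i -> C}),
    is_coproduct inj -> (forall i, X (M i)) -> X C.

Definition finite_sum_closed X : Prop :=
  forall (I : finType) (M : I -> lmodType R) (C : lmodType R)
    (inj : forall i, {linear M i -> C}),
    is_coproduct inj -> (forall i, X (M i)) -> X C.

End Closure.

Definition duality_pair_along (S T : pzRingType)
    (char : lmodType S -> lmodType T) (L : modclass S) (A : modclass T) : Prop :=
  [/\ forall M, L M <-> A (char M), summand_closed A & finite_sum_closed A].

Section DualityPairs.
Variables (R : pzRingType) (L : modclass R) (A : modclass R^c).

Definition duality_pair_left : Prop :=
  duality_pair_along (fun M : lmodType R => char_left M : lmodType R^c) L A.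

Definition duality_pair_right : Prop :=
  duality_pair_along (fun M : lmodType R^c => char_right M : lmodType R) A L.

Definition perfect_duality_pair : Prop :=
  [/\ duality_pair_left, L R^o, coproduct_closed L & extension_closed L].

Definition complete_duality_pair : Prop :=
  perfect_duality_pair /\ duality_pair_right.

End DualityPairs.

Section Projective.
Variable R : pzRingType.

Definition projective (P : lmodType R) : Prop :=
  forall (M N : lmodType R) (g : {linear M -> N}) (f : {linear P -> N}),
    surj g -> exists h : {linear P -> M}, forall x, g (h x) = f x.

(* Only the class L of the duality pair (L, A) enters the definition.  The
   complex is indexed homologically by int, and the last clause identifies
   M with the kernel of P_{-1} -> P_{-2}. *)
Definition gorenstein_projective (L : modclass R) (M : lmodType R) : Prop :=
  exists (P : int -> lmodType R) (d : forall i, {linear P i -> P (i - 1)}),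
    [/\ forall i, projective (P i),
        forall i, exact (d i) (d (i - 1)),
        forall N, L N -> forall i (f : {linear P (i - 1) -> N}),
          (forall x, f (d i x) = 0) <->
          exists g : {linear P (i - 1 - 1) -> N},
            forall x, f x = g (d (i - 1) x)
      & exists j : {linear M -> P (-1)}, injective j /\ exact j (d (-1))].

Definition projective_resolution (X : lmodType R) (P : nat -> lmodType R)
    (d : forall n, {linear P n.+1 -> P n}) (e : {linear P 0%N -> X}) : Prop :=
  [/\ forall n, projective (P n), surj e, exact (d 0%N) e
    & forall n, exact (d n.+1) (d n)].

Definition coboundary (P : nat -> lmodType R)
    (d : forall n, {linear P n.+1 -> P n}) (W : lmodType R) (j : nat) :
    {linear P j -> W} -> Prop :=
  match j return {linear P j -> W} -> Prop with
  | 0 => fun f => forall x, f x = 0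
  | n.+1 => fun f => exists g : {linear P n -> W}, forall x, f x = g (d n x)
  end.

(* Ext^j(X, W) = H^j(Hom(P, W)) for a projective resolution P of X; since this
   does not depend on P, its vanishing may be asked for every resolution. *)
Definition Ext_eq0 (j : nat) (X W : lmodType R) : Prop :=
  forall (P : nat -> lmodType R) (d : forall n, {linear P n.+1 -> P n})
    (e : {linear P 0%N -> X}), projective_resolution d e ->
  forall f : {linear P j -> W}, (forall x, f (d j x) = 0) -> coboundary d f.

End Projective.

(* A \otimes_R M is the quotient of the free abelian group on A * M by the
   subgroup generated by the relators below. *)
Section Tensor.
Variables (R : pzRingType) (A : lmodType R^c) (M : lmodType R).

Local Notation F := {freeg (A * M)%type}.

Inductive tensor_rel : F -> Prop :=
| TensorDl a a' m :
    tensor_rel (<< (a + a', m) >> - (<< (a, m) >> + << (a', m) >>))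
| TensorDr a m m' :
    tensor_rel (<< (a, m + m') >> - (<< (a, m) >> + << (a, m') >>))
| TensorZ (r : R) a m :
    tensor_rel (<< ((r : R^c) *: a, m) >> - << (a, r *: m) >>)
| Tensor0 : tensor_rel 0
| TensorB x y : tensor_rel x -> tensor_rel y -> tensor_rel (x - y).

Definition tensor_relb : pred F := fun x => `[< tensor_rel x >].

Fact tensor_rel_closed : zmod_closed tensor_relb.
Proof.
split=> [|x y /asboolP Tx /asboolP Ty]; apply/asboolP; first exact: Tensor0.
exact: TensorB.
Qed.

HB.instance Definition _ := GRing.isZmodClosed.Build F tensor_relb
  tensor_rel_closed.

Definition tensor_sub : zmodClosed F :=
  GRing.ZmodClosed.clone F tensor_relb _.

Definition tensor : zmodType := {ideal_quot tensor_sub}.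

Definition tens (a : A) (m : M) : tensor :=
  \pi_{ideal_quot tensor_sub} << (a, m) >>.

Lemma tens_eqP (x y : F) :
  \pi_{ideal_quot tensor_sub} x = \pi_{ideal_quot tensor_sub} y <->
  tensor_rel (x - y).
Proof.
split=> [/eqP|Txy]; first by rewrite -Quotient.idealrBE => /asboolP.
by apply/eqP; rewrite -Quotient.idealrBE; apply/asboolP.
Qed.

End Tensor.

Section TensorMap.
Variables (R : pzRingType) (A B : lmodType R^c) (M : lmodType R).
Variable f : {linear A -> B}.

Definition tensor_map_freeg (x : {freeg (A * M)%type}) : {freeg (B * M)%type} :=
  fglift (fun am => << (f am.1, am.2) >>) x.

Definition tensor_map (x : tensor A M) : tensor B M :=
  \pi_{ideal_quot tensor_sub B M} (tensor_map_freeg (repr x)).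

Fact tensor_map_freegB x y :
  tensor_map_freeg (x - y) = tensor_map_freeg x - tensor_map_freeg y.
Proof. exact: lift_is_additive. Qed.

Fact tensor_map_freegU a m : tensor_map_freeg << (a, m) >> = << (f a, m) >>.
Proof. by rewrite /tensor_map_freeg liftU scale1r. Qed.

Fact tensor_map_rel x : tensor_rel x -> tensor_rel (tensor_map_freeg x).
Proof.
have fD u v : tensor_map_freeg (u + v) = tensor_map_freeg u + tensor_map_freeg v.
  have f0 : tensor_map_freeg 0 = 0 by rewrite -(subrr 0) tensor_map_freegB subrr.
  by rewrite -[v in LHS]opprK tensor_map_freegB -[- v]sub0r tensor_map_freegB
             f0 sub0r opprK.
elim=> {x} [a a' m|a m m'|r a m||x y _ IHx _ IHy];
  rewrite ?tensor_map_freegB ?fD ?tensor_map_freegU.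
- by rewrite linearD; apply: TensorDl.
- exact: TensorDr.
- by rewrite linearZ; apply: TensorZ.
- by rewrite -(subrr 0) tensor_map_freegB subrr; apply: Tensor0.
- exact: TensorB.
Qed.

Lemma tensor_mapE a m : tensor_map (tens a m) = tens (f a) m.
Proof.
rewrite /tensor_map /tens -tensor_map_freegU; apply/tens_eqP.
by rewrite -tensor_map_freegB; apply/tensor_map_rel/tens_eqP; rewrite reprK.
Qed.

Lemma tensor_map_is_additive : {morph tensor_map : x y / x - y}.
Proof.
move=> x y; rewrite /tensor_map -raddfB -tensor_map_freegB; apply/tens_eqP.
rewrite -tensor_map_freegB; apply/tensor_map_rel/tens_eqP.
by rewrite raddfB /= !reprK.
Qed.

End TensorMap.

Section Flat.
Variable R : pzRingType.

Definition flat (M : lmodType R) : Prop :=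
  forall (A B C : lmodType R^c) (f : {linear A -> B}) (g : {linear B -> C}),
    exact f g -> exact (tensor_map (M := M) f) (tensor_map (M := M) g).

Definition left_perfect : Prop :=
  forall M : lmodType R, flat M -> projective M.

End Flat.

Section Frobenius.
Variable R : pzRingType.
Implicit Types X W : modclass R.

Definition left_thick X : Prop :=
  [/\ summand_closed X, extension_closed X & epi_kernel_closed X].

Definition injective_wrt X W : Prop :=
  forall M N, X M -> W N -> forall j, (1 <= j)%N -> Ext_eq0 j M N.

Definition projective_wrt X W : Prop :=
  forall M N, X M -> W N -> forall j, (1 <= j)%N -> Ext_eq0 j N M.

Definition relative_cogenerator X W : Prop :=
  (forall M, W M -> X M) /\
  (forall M, X M -> exists (N M' : lmodType R)
     (f : {linear M -> N}) (g : {linear N -> M'}),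
     [/\ short_exact f g, W N & X M']).

Definition relative_generator X W : Prop :=
  (forall M, W M -> X M) /\
  (forall M, X M -> exists (N M' : lmodType R)
     (f : {linear M' -> N}) (g : {linear N -> M}),
     [/\ short_exact f g, W N & X M']).

Definition left_frobenius_pair X W : Prop :=
  [/\ left_thick X, injective_wrt X W, relative_cogenerator X W
    & summand_closed W].

Definition strong_left_frobenius_pair X W : Prop :=
  [/\ left_frobenius_pair X W, projective_wrt X W & relative_generator X W].

End Frobenius.

(* Main.v *)
(* If L lies in GP, an M in L is the kernel of a step M -> P -> M' that stays
   exact under Hom(-, M), so the identity of M extends to P and M is projective;
   conversely projectives are retracts of coproducts of copies of R and so lie
   in L.

   Gorenstein projectivity is treated coinductively: M is totally resolved if it
   lies in some class each of whose members M can be prolonged on both sides by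
   short exact sequences 0 -> M -> P -> M' -> 0 with P projective, exact under
   Hom(-, L), and outer terms in the class.  Closure under extensions is then
   the horseshoe construction.  For summands, if M + M' is totally resolved and
   0 -> M -> P -> C -> 0 comes from truncating its step, then C + M is an
   extension of totally resolved modules, so no infinite swindle is needed.  For
   kernels A of B -> C, lifting a projective Q onto C to B exhibits A + Q as an
   extension of B by the kernel of Q -> C.

   If M is flat and F -> M is onto with F free, then M^+ is injective, hence a
   summand of F^+; as F is in L, F^+ is in A, so M^+ is in A and M is in L. *)

From HB Require Import structures.
From mathcomp Require Import all_boot all_order all_algebra.
From mathcomp Require Import boolp classical_sets functions freeg.
Require Import Defs.

Set Implicit Arguments.
Unset Strict Implicit.
Unset Printing Implicit Defensive.

Import GRing.Theory.
Local Open Scope ring_scope.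
Local Open Scope quotient_scope.

(** * Constructing linear maps: descent, factorization, pairing *)

Section LinearMaps.
Variable R : pzRingType.
Implicit Types M N X : lmodType R.

Lemma linear_exists M N (f : M -> N) :
  linear f -> exists h : {linear M -> N}, h =1 f.
Proof.
move=> f_lin; pose linM := GRing.isLinear.Build R M N *:%R f f_lin.
pose h : {linear M -> N} := HB.pack f linM.
by exists h.
Qed.

(** The witness is [f] after a set-theoretic section of [s]. The section need not be linear, but [f]
    is constant on the fibres of [s], so the composite is. *)
Lemma linear_descends X M N (s : {linear X -> M}) (f : {linear X -> N}) :
    surj s -> (forall x, s x = 0 -> f x = 0) ->
  exists h : {linear M -> N}, forall x, h (s x) = f x.
Proof.
move=> s_surj s_f; pose t y := sval (cid (s_surj y)).
have tK y : s (t y) = y by rewrite /t; case: cid.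
have fE x y : s x = s y -> f x = f y.
  move=> sxy; apply/eqP; rewrite -subr_eq0 -linearB; apply/eqP/s_f.
  by rewrite linearB sxy subrr.
have [|h hE] := @linear_exists M N (f \o t).
  by move=> a x y /=; rewrite -linearP; apply: fE; rewrite linearP !tK.
by exists h => x; rewrite hE; apply: fE; rewrite tK.
Qed.

(** Injectivity of [j] makes the choice of preimages unique, hence linear. *)
Lemma linear_factors X M N (j : {linear M -> N}) (f : {linear X -> N}) :
    injective j -> (forall x, exists m, j m = f x) ->
  exists h : {linear X -> M}, forall x, j (h x) = f x.
Proof.
move=> j_inj /choice[t tE].
have [|h hE] := @linear_exists X M t; last by exists h => x; rewrite hE.
by move=> a x y; apply: j_inj; rewrite linearP !tE linearP.
Qed.

Lemma linear_inj0 M N (j : {linear M -> N}) :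
  (forall x, j x = 0 -> x = 0) -> injective j.
Proof.
move=> j0 x y jxy; apply/eqP; rewrite -subr_eq0; apply/eqP/j0.
by rewrite linearB jxy subrr.
Qed.

Lemma injective_eq0 M N (j : {linear M -> N}) x :
  injective j -> j x = 0 -> x = 0.
Proof. by move=> j_inj jx; apply: j_inj; rewrite jx linear0. Qed.

Lemma linear_pair X M N (f : {linear X -> M}) (g : {linear X -> N}) :
  exists h : {linear X -> (M * N)%type}, forall x, h x = (f x, g x).
Proof.
by apply: (@linear_exists X (M * N)%type (fun x => (f x, g x))) => a x y;
  rewrite !linearP.
Qed.

Lemma linear_copair X M N (f : {linear M -> X}) (g : {linear N -> X}) :
  exists h : {linear (M * N)%type -> X}, forall x y, h (x, y) = f x + g y.
Proof.
have [|h hE] := @linear_exists (M * N)%type X (fun x => f x.1 + g x.2).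
  by move=> a [x y] [x' y'] /=; rewrite !linearP scalerDr addrACA.
by exists h => x y; rewrite hE.
Qed.

Lemma linear_inl M N :
  exists h : {linear M -> (M * N)%type}, forall x, h x = (x, 0).
Proof. exact: (linear_pair (idfun : {linear M -> M}) (\0 : {linear M -> N})). Qed.

Lemma linear_inr M N :
  exists h : {linear N -> (M * N)%type}, forall x, h x = (0, x).
Proof. exact: (linear_pair (\0 : {linear N -> M}) (idfun : {linear N -> N})). Qed.

End LinearMaps.

(** * Submodules and quotient modules of a predicate *)

Section Submodules.
Variables (R : pzRingType) (M : lmodType R) (S : M -> Prop).
Hypotheses (S0 : S 0) (S_lin : forall a x y, S x -> S y -> S (a *: x + y)).

Definition submodule_pred : pred M := fun x => `[<S x>].

Fact submodule_pred_closed : submod_closed submodule_pred.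
Proof.
split=> [|a x y /asboolP Sx /asboolP Sy]; apply/asboolP => //.
exact: S_lin.
Qed.

HB.instance Definition _ := GRing.isSubmodClosed.Build R M submodule_pred
  (GRing.submod_closed_semi submodule_pred_closed).
HB.instance Definition _ := GRing.isZmodClosed.Build M submodule_pred
  (GRing.submod_closedB submodule_pred_closed).

Record submodule := Submodule { submodule_val : M; _ : submodule_pred submodule_val }.

HB.instance Definition _ := [isSub for submodule_val].
HB.instance Definition _ := [Choice of submodule by <:].
HB.instance Definition _ := [SubChoice_isSubLmodule of submodule by <:].

(** A submodule is presented as an injective linear map with prescribed image, so that later
    arguments see kernels only through such maps. *)
Lemma submodule_exists : exists (K : lmodType R) (j : {linear K -> M}),
  injective j /\ forall x, S x <-> exists k, j k = x.
Proof.
exists submodule, (val : submodule -> M).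
split=> [|x]; first exact: val_inj.
split=> [Sx|[k <-]]; last exact/asboolP/(valP k).
by exists (Submodule (asboolT Sx)).
Qed.

Definition submodule_zmod : zmodClosed M :=
  GRing.ZmodClosed.clone M submodule_pred _.

Definition quotmod : Type := {ideal_quot submodule_zmod}.
HB.instance Definition _ := GRing.Zmodule.on quotmod.
Definition quotmod_pi (x : M) : quotmod := \pi_{ideal_quot submodule_zmod} x.

Lemma quotmod_eqP x y : quotmod_pi x = quotmod_pi y <-> S (x - y).
Proof.
split=> [/eqP|Sxy]; first by rewrite -Quotient.idealrBE => /asboolP.
by apply/eqP; rewrite -Quotient.idealrBE; apply/asboolP.
Qed.

Fact quotmod_piD : {morph quotmod_pi : x y / x + y}.
Proof. by move=> x y; rewrite /quotmod_pi raddfD. Qed.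

Definition quotmod_repr (x : quotmod) : M :=
  repr (x : {ideal_quot submodule_zmod}).

Fact quotmod_reprK x : quotmod_pi (quotmod_repr x) = x.
Proof. exact: reprK. Qed.

Definition quotmod_scale (a : R) (x : quotmod) := quotmod_pi (a *: quotmod_repr x).

(** Scaling is computed on a chosen representative; closure of [S] under scaling makes the choice
    irrelevant. The module axioms are then inherited from [M]. *)
Fact quotmod_scaleE a x : quotmod_scale a (quotmod_pi x) = quotmod_pi (a *: x).
Proof.
apply/quotmod_eqP; rewrite -scalerBr -[_ *: _]addr0.
by apply: S_lin => //; apply/quotmod_eqP; rewrite quotmod_reprK.
Qed.

Fact quotmod_scaleA a b x :
  quotmod_scale a (quotmod_scale b x) = quotmod_scale (a * b) x.
Proof. by rewrite -[x]quotmod_reprK !quotmod_scaleE scalerA. Qed.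
Fact quotmod_scale1 : left_id 1 quotmod_scale.
Proof. by move=> x; rewrite -[x]quotmod_reprK !quotmod_scaleE scale1r. Qed.
Fact quotmod_scaleDr : right_distributive quotmod_scale +%R.
Proof.
move=> a x y; rewrite -[x]quotmod_reprK -[y]quotmod_reprK -quotmod_piD.
by rewrite !quotmod_scaleE scalerDr quotmod_piD.
Qed.
Fact quotmod_scaleDl x : {morph quotmod_scale^~ x : a b / a + b}.
Proof.
move=> a b; rewrite -[x]quotmod_reprK.
by rewrite !quotmod_scaleE scalerDl quotmod_piD.
Qed.

HB.instance Definition _ := GRing.Zmodule_isLmodule.Build R quotmod
  quotmod_scaleA quotmod_scale1 quotmod_scaleDr quotmod_scaleDl.

Lemma quotient_exists : exists (Q : lmodType R) (p : {linear M -> Q}),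
  surj p /\ forall x, p x = 0 <-> S x.
Proof.
have [|p pE] := @linear_exists R M quotmod quotmod_pi.
  by move=> a x y; rewrite quotmod_piD -quotmod_scaleE.
exists quotmod, p; split=> [y|x].
  by exists (quotmod_repr y); rewrite pE quotmod_reprK.
rewrite pE; have ->: 0 = quotmod_pi 0 by rewrite /quotmod_pi raddf0.
by rewrite quotmod_eqP subr0.
Qed.

End Submodules.

(** * Kernels, cokernels and short exact sequences *)

Section ShortExactSequences.
Variable R : pzRingType.
Implicit Types A B C M N P : lmodType R.

Lemma kernel_exists M N (f : {linear M -> N}) :
  exists (K : lmodType R) (j : {linear K -> M}), injective j /\ exact j f.
Proof.
apply: (submodule_exists (S := fun x => f x = 0)); first exact: linear0.
by move=> a x y fx fy; rewrite linearP fx fy scaler0 addr0.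
Qed.

Lemma short_exact_kernel M N (f : {linear M -> N}) :
  surj f -> exists (K : lmodType R) (j : {linear K -> M}), short_exact j f.
Proof. by have [K [j []]] := kernel_exists f; exists K, j; split. Qed.

Lemma short_exact_cokernel M N (f : {linear M -> N}) :
  injective f -> exists (Q : lmodType R) (p : {linear N -> Q}), short_exact f p.
Proof.
move=> f_inj.
have [||Q [p [p_surj pE]]] :=
    @quotient_exists R N (fun y => exists x, f x = y).
- by exists 0; rewrite linear0.
- by move=> a _ _ [x <-] [y <-]; exists (a *: x + y); rewrite linearP.
by exists Q, p; split.
Qed.

Lemma short_exact_comp0 A B C (f : {linear A -> B}) (g : {linear B -> C}) x :
  short_exact f g -> g (f x) = 0.
Proof. by case=> _ fg _; apply/fg; exists x. Qed.

End ShortExactSequences.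

(** * Totally resolved modules and their closure properties *)

Section TotalResolutions.
Variables (R : pzRingType) (L : modclass R).
Implicit Types A B C K M N P Q Z : lmodType R.

Lemma projective_prod P Q :
  projective P -> projective Q -> projective (P * Q)%type.
Proof.
move=> projP projQ M N g f g_surj.
have [i iE] := linear_inl P Q; have [j jE] := linear_inr P Q.
have [h hE] := projP M N g (f \o i) g_surj.
have [k kE] := projQ M N g (f \o j) g_surj.
have [l lE] := linear_copair h k; exists l => -[x y].
rewrite lE linearD hE kE /= iE jE -linearD; congr (f _).
by congr pair; rewrite ?addr0 ?add0r.
Qed.

Definition extends M P (q : {linear M -> P}) : Prop :=
  forall N, L N -> forall f : {linear M -> N},
  exists g : {linear P -> N}, forall x, g (q x) = f x.

(* [extends] is Hom(-, L)-exactness of the sequence. *)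
Definition step M M' : Prop :=
  exists (P : lmodType R) (q : {linear M -> P}) (p : {linear P -> M'}),
    [/\ projective P, short_exact q p & extends q].

Definition totally_resolved M : Prop := exists Y : modclass R, Y M /\
  forall N, Y N -> (exists N', Y N' /\ step N N') /\ (exists N', Y N' /\ step N' N).

Lemma totally_resolved_next M : totally_resolved M ->
  exists M', totally_resolved M' /\ step M M'.
Proof.
move=> [Y [YM Ystep]]; have [[M' [YM' st]] _] := Ystep _ YM.
by exists M'; split=> //; exists Y.
Qed.

Lemma totally_resolved_prev M : totally_resolved M ->
  exists M', totally_resolved M' /\ step M' M.
Proof.
move=> [Y [YM Ystep]]; have [_ [M' [YM' st]]] := Ystep _ YM.
by exists M'; split=> //; exists Y.
Qed.

(* Hom(-, N)-exactness of the step into C amounts to Ext^1(C, N) = 0, which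
   makes every extension of C by A Hom(-, N)-exact. *)
Lemma step_extends K A B C (f : {linear A -> B}) (g : {linear B -> C}) :
  step K C -> short_exact f g -> extends f.
Proof.
move=> [P [q [p [projP qp q_ext]]]] fg N LN a.
have [f_inj fg_ex g_surj] := fg; have [q_inj qp_ex p_surj] := qp.
have [w wE] := projP _ _ g p g_surj.
have [|k kE] := linear_factors (f := w \o q) f_inj.
  by move=> x; apply/fg_ex; rewrite /= wE (short_exact_comp0 _ qp).
have [b bE] := q_ext N LN (a \o k).
have [s sE] := linear_copair f w; have [c cE] := linear_copair a b.
(* Since [f \o k] equals [w \o q], [B] is the quotient of [A * P] by the copy of [K] embedded
   through [(- k, q)]. The map [c] kills that copy because [b] extends [a \o k] along [q]. *)
have [||h hE] := @linear_descends R _ _ _ s c.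
- move=> y; have [z zE] := p_surj (g y).
  have /fg_ex[x xE]: g (y - w z) = 0 by rewrite linearB wE zE subrr.
  by exists (x, z); rewrite sE xE subrK.
- move=> [x z]; rewrite sE cE => fw0.
  have pz0 : p z = 0.
    by rewrite -wE -[w z](addKr (f x)) fw0 addr0 linearN (short_exact_comp0 _ fg) oppr0.
  have /qp_ex[t tE] := pz0.
  suff ->: x = - k t by rewrite linearN -tE bE addNr.
  by apply: f_inj; apply/eqP; rewrite linearN kE /= tE -addr_eq0 fw0.
by exists h => x; rewrite -[f x]addr0 -(linear0 w) -sE hE cE linear0 addr0.
Qed.

(** Extend the restriction of the given map to [A] over [P]. Pulled back to [B], this extension
    differs from the given map by a map that vanishes on [A], hence descends to [C] and extends over
    [Q]; the two extensions add up. Both directions of the horseshoe use this. *)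
Lemma extends_middle A B C P Q (f : {linear A -> B}) (g : {linear B -> C})
    (q : {linear A -> P}) (u : {linear C -> Q}) (i : {linear B -> (P * Q)%type}) :
    short_exact f g -> extends q -> extends u ->
    (forall x, i (f x) = (q x, 0)) -> (forall y, (i y).2 = u (g y)) ->
  extends i.
Proof.
move=> [f_inj fg_ex g_surj] q_ext u_ext if_E i2_E N LN a.
have [b bE] := q_ext N LN (a \o f).
have [a' a'E] := linear_copair a (\- b).
have [k kE] := linear_pair (idfun : {linear B -> B}) (fst \o i).
have [|c cE] := @linear_descends R _ _ _ g (a' \o k) g_surj.
  move=> y /fg_ex[x <-].
  by rewrite /= kE a'E /= if_E bE subrr.
have [d dE] := u_ext N LN c.
have [h hE] := linear_copair b d; exists h => y.
rewrite [i y]surjective_pairing hE i2_E dE cE /= kE a'E /=.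
by rewrite addrCA subrr addr0.
Qed.

Hypothesis projL : forall P, projective P -> L P.

(** Horseshoe to the right: [B] is embedded in [P * Q], and the cokernels of the three embeddings
    again form a short exact sequence. *)
Lemma extension_next A B C (f : {linear A -> B}) (g : {linear B -> C}) :
    short_exact f g -> totally_resolved A -> totally_resolved C ->
  exists A' B' C' (f' : {linear A' -> B'}) (g' : {linear B' -> C'}),
    [/\ short_exact f' g', totally_resolved A', totally_resolved C' & step B B'].
Proof.
move=> fg totA totC; have [f_inj fg_ex g_surj] := fg.
have [A' [totA' [P [q [p [projP qp q_ext]]]]]] := totally_resolved_next totA.
have [C' [totC' [Q [u [v [projQ uv u_ext]]]]]] := totally_resolved_next totC.
have [K [_ stKC]] := totally_resolved_prev totC.
have [q_inj qp_ex p_surj] := qp; have [u_inj uv_ex v_surj] := uv.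
(* The embedding of [A] into [P] must extend to [B]. It does because [P] lies in [L] and some step
   ends at [C]. *)
have [a aE] := step_extends stKC fg (projL projP) q.
have [i iE] := linear_pair a (u \o g).
have ifE x : i (f x) = (q x, 0).
  by rewrite iE aE /= (short_exact_comp0 _ fg) linear0.
have i_inj : injective i.
  apply: linear_inj0 => y; rewrite iE => -[ay /(injective_eq0 u_inj)/fg_ex[x xy]].
  by move: ay; rewrite -xy aE => /(injective_eq0 q_inj) ->; rewrite linear0.
have [B' [r ir]] := short_exact_cokernel i_inj.
have [_ ir_ex r_surj] := ir.
have [l lE] := linear_inl P Q.
have [|f' f'E] := @linear_descends R _ _ _ p (r \o l) p_surj.
  by move=> y /qp_ex[x <-]; rewrite /= lE -ifE (short_exact_comp0 _ ir).
have [|g' g'E] := @linear_descends R _ _ _ r (v \o snd) r_surj.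
  by move=> y /ir_ex[x <-]; rewrite /= iE (short_exact_comp0 _ uv).
exists A', B', C', f', g'; split=> //; last first.
  exists (P * Q)%type, i, r; split=> //; first exact: projective_prod.
  by apply: (extends_middle fg q_ext u_ext) => // y; rewrite iE.
split.
- apply: linear_inj0 => x; have [y <-] := p_surj x.
  rewrite f'E /= lE => /ir_ex[b]; rewrite iE => -[ay].
  move=> /(injective_eq0 u_inj)/fg_ex[z zb].
  by rewrite -ay -zb aE (short_exact_comp0 _ qp).
- move=> z; split=> [|[x <-]]; last first.
    by have [y <-] := p_surj x; rewrite f'E /= g'E /= lE linear0.
  have [[x y] <-] := r_surj z; rewrite g'E /= => /uv_ex[c cy].
  (* Subtracting [i b] from the representative [(x, y)] clears its second component and leaves
     [(x - a b, 0)], which comes from [P]. *)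
  have [b bc] := g_surj c; exists (p (x - a b)); rewrite f'E /= lE.
  apply/eqP; rewrite -subr_eq0 -linearB; apply/eqP/ir_ex; exists (- b).
  rewrite linearN iE /= bc cy; apply/eqP; rewrite xpair_eqE /=.
  by rewrite [x - _]addrC addrK sub0r !eqxx.
- move=> z; have [y yz] := v_surj z; exists (r (0, y)).
  by rewrite g'E /= yz.
Qed.

(** Horseshoe to the left: projectivity of [Q] lifts [v] through [g], which gives a cover of [B] by
    [P * Q]; the kernels of the three covers form the new sequence. *)
Lemma extension_prev A B C (f : {linear A -> B}) (g : {linear B -> C}) :
    short_exact f g -> totally_resolved A -> totally_resolved C ->
  exists A' B' C' (f' : {linear A' -> B'}) (g' : {linear B' -> C'}),
    [/\ short_exact f' g', totally_resolved A', totally_resolved C' & step B' B].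
Proof.
move=> fg totA totC; have [f_inj fg_ex g_surj] := fg.
have [A' [totA' [P [q [p [projP qp q_ext]]]]]] := totally_resolved_prev totA.
have [C' [totC' [Q [u [v [projQ uv u_ext]]]]]] := totally_resolved_prev totC.
have [q_inj qp_ex p_surj] := qp; have [u_inj uv_ex v_surj] := uv.
have [w wE] := projQ _ _ g v g_surj.
have [r rE] := linear_copair (f \o p) w.
have gr x y : g (r (x, y)) = v y.
  by rewrite rE linearD (short_exact_comp0 _ fg) add0r wE.
have r_surj : surj r.
  move=> b; have [y yb] := v_surj (g b).
  have /fg_ex[a ab]: g (b - w y) = 0 by rewrite linearB wE yb subrr.
  by have [x xa] := p_surj a; exists (x, y); rewrite rE /= xa ab subrK.
have [B' [i ir]] := short_exact_kernel r_surj.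
have [i_inj ir_ex _] := ir.
have [l lE] := linear_pair q (\0 : {linear A' -> Q}).
have [|f' f'E] := @linear_factors R _ _ _ i l i_inj.
  by move=> x; apply/ir_ex; rewrite lE rE /= (short_exact_comp0 _ qp) !linear0 addr0.
have [|g' g'E] := @linear_factors R _ _ _ u (snd \o i) u_inj.
  move=> b; apply/uv_ex; rewrite /= -(gr (i b).1) -surjective_pairing.
  by rewrite (short_exact_comp0 _ ir) linear0.
have fg' : short_exact f' g'.
  split.
  - apply: linear_inj0 => x f'x; have: i (f' x) = 0 by rewrite f'x linear0.
    by rewrite f'E lE => -[/(injective_eq0 q_inj)].
  - move=> b; split=> [gb|[x <-]]; last first.
      by apply: u_inj; rewrite g'E /= f'E lE linear0.
    have := g'E b; rewrite gb linear0 /= => ib2.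
    have := short_exact_comp0 b ir; rewrite [i b]surjective_pairing -ib2 rE.
    rewrite linear0 addr0 /= => /(injective_eq0 f_inj)/qp_ex[x xb].
    by exists x; apply: i_inj; rewrite f'E lE xb [RHS]surjective_pairing -ib2.
  - move=> c; have: g (w (u c)) = 0 by rewrite wE (short_exact_comp0 _ uv).
    move=> /fg_ex[a ac]; have [x xa] := p_surj a.
    have /ir_ex[b bE]: r (- x, u c) = 0.
      by rewrite rE /= !linearN xa ac addNr.
    by exists b; apply: u_inj; rewrite g'E /= bE.
exists A', B', C', f', g'; split=> //.
exists (P * Q)%type, i, r; split=> //; first exact: projective_prod.
apply: (extends_middle fg' q_ext u_ext) => [x|b]; first by rewrite f'E lE.
by rewrite g'E.
Qed.

(** The middle terms of extensions of totally resolved modules form a class that the two horseshoes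
    prolong in both directions, as coinduction requires. *)
Lemma totally_resolved_extension : extension_closed totally_resolved.
Proof.
move=> A B C f g fg totA totC.
exists (fun B => exists A C (f : {linear A -> B}) (g : {linear B -> C}),
  [/\ short_exact f g, totally_resolved A & totally_resolved C]).
split=> [|{A B C f g fg totA totC} B [A [C [f [g [fg totA totC]]]]]].
  by exists A, C, f, g.
split.
  have [A' [B' [C' [f' [g' [fg' tA tC st]]]]]] := extension_next fg totA totC.
  by exists B'; split=> //; exists A', C', f', g'.
have [A' [B' [C' [f' [g' [fg' tA tC st]]]]]] := extension_prev fg totA totC.
by exists B'; split=> //; exists A', C', f', g'.
Qed.

Lemma trivial_module_exists : exists Z : lmodType R, forall z : Z, z = 0.
Proof.
have id_surj : surj (idfun : {linear R^o -> R^o}) by move=> y; exists y.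
have [Z [j jid]] := short_exact_kernel id_surj; exists Z => z.
by case: (jid) => j_inj _ _; apply/(injective_eq0 j_inj)/(short_exact_comp0 z jid).
Qed.

Lemma trivial_projective (Z : lmodType R) : (forall z : Z, z = 0) -> projective Z.
Proof.
move=> Z0 M N g f _; exists (\0 : {linear Z -> M}) => z.
by rewrite [z]Z0 !linear0.
Qed.

Lemma short_exact_bijl M N Z (f : {linear M -> N}) : (forall z : Z, z = 0) ->
  bijective f -> short_exact f (\0 : {linear N -> Z}).
Proof.
move=> Z0 f_bij; have [f' _ f'K] := f_bij; split=> [||z].
- exact: bij_inj f_bij.
- by move=> y; split=> // _; exists (f' y).
- by exists 0; rewrite [RHS]Z0.
Qed.

Lemma short_exact_bijr M N Z (f : {linear M -> N}) : (forall z : Z, z = 0) ->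
  bijective f -> short_exact (\0 : {linear Z -> M}) f.
Proof.
move=> Z0 f_bij; have [f' fK f'K] := f_bij; split=> [z z' _|x|y].
- by rewrite [z]Z0 [z']Z0.
- split=> [/(injective_eq0 (bij_inj f_bij)) ->|[z <-]]; last exact: linear0.
  by exists 0.
- by exists (f' y).
Qed.

(** The projectives form an invariant class: the identity of [P] is a step from [P] to zero and also
    a step from zero to [P]. *)
Lemma totally_resolved_projective P : projective P -> totally_resolved P.
Proof.
move=> projP; exists (@projective R); split=> // {P projP} P projP.
have [Z Z0] := trivial_module_exists.
have id_bij : bijective (idfun : {linear P -> P}) by exists idfun.
split; exists Z; (split; first exact: trivial_projective).
  exists P, (idfun : {linear P -> P}), (\0 : {linear P -> Z}).
  by split=> // [|N _ f]; [exact: short_exact_bijl | exists f].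
exists P, (\0 : {linear Z -> P}), (idfun : {linear P -> P}).
split=> // [|N _ f]; first exact: short_exact_bijr.
by exists (\0 : {linear P -> N}) => z; rewrite [z]Z0 !linear0.
Qed.

(** An isomorphism is an extension with zero quotient. *)
Lemma totally_resolved_iso : iso_closed totally_resolved.
Proof.
move=> M N f f_bij totM; have [Z Z0] := trivial_module_exists.
apply: (totally_resolved_extension (short_exact_bijl Z0 f_bij) totM).
exact/totally_resolved_projective/trivial_projective.
Qed.

(** Adding the identity of [M'] to [g] gives an extension of [M * M'] by [A], to which the step
    ending at [M * M'] applies; in other words, Ext^1 of a summand is a summand of Ext^1. *)
Lemma step_extends_summand K A B M M' (f : {linear A -> B})
    (g : {linear B -> M}) :
  step K (M * M')%type -> short_exact f g -> extends f.
Proof.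
move=> stK fg N LN a; have [f_inj fg_ex g_surj] := fg.
have [f' f'E] := linear_pair f (\0 : {linear A -> M'}).
have [g' g'E] := linear_pair (g \o fst) (snd : {linear (B * M')%type -> M'}).
have [|b bE] := @step_extends K _ _ _ f' g' stK _ N LN a.
  split.
  - by apply: linear_inj0 => x; rewrite f'E => /(congr1 fst)/(injective_eq0 f_inj).
  - move=> [y z]; rewrite g'E /=; split=> [[/fg_ex[x <-] ->]|[x]].
      by exists x; rewrite f'E.
    by rewrite f'E => -[<- <-]; rewrite (short_exact_comp0 _ fg).
  - move=> [y z]; have [x <-] := g_surj y; exists (x, z).
    by rewrite g'E.
have [l lE] := linear_inl B M'; exists (b \o l) => x.
by rewrite -bE f'E /= lE.
Qed.

(** The quotient [C] of [P] by [M] maps onto [G], the quotient of [P] by [M * M'], with kernel [M'].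
    A spare copy of [M] next to [C] enlarges this kernel to the totally resolved [M * M']. *)
Lemma summand_next M M' : totally_resolved (M * M')%type ->
  exists C, totally_resolved (C * M)%type /\ step M C.
Proof.
move=> totMM'; have [G [totG [P [q [p [projP qp q_ext]]]]]] :=
  totally_resolved_next totMM'.
have [q_inj qp_ex p_surj] := qp.
have [l lE] := linear_inl M M'; have [r rE] := linear_inr M M'.
have ql_inj : injective (q \o l).
  by apply: linear_inj0 => x /=; rewrite lE => /(injective_eq0 q_inj)[].
have [C [c qlc]] := short_exact_cokernel ql_inj; have [_ qlc_ex c_surj] := qlc.
exists C; split; last first.
  exists P, (q \o l : {linear M -> P}), c; split=> // N LN f.
  have [g gE] := q_ext N LN (f \o fst); exists g => x.
  by rewrite gE /= lE.
have [i iE] := linear_pair (c \o q \o r \o snd) (fst : {linear (M * M')%type -> M}).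
have [|s sE] := @linear_descends R _ _ _ c p c_surj.
  by move=> x /qlc_ex[y <-]; rewrite (short_exact_comp0 _ qp).
apply: (totally_resolved_extension (f := i) (g := s \o fst) _ totMM' totG).
split.
- apply: linear_inj0 => -[x y]; rewrite iE /= rE => -[/qlc_ex[z]] /= + ->.
  by rewrite lE => /q_inj[_ <-].
- move=> [d x]; have [y <-] := c_surj d; rewrite /= sE.
  split=> [/qp_ex[[x1 x2] <-]|[[x1 x2]]]; last first.
    by rewrite iE /= => -[cE _]; rewrite -sE -cE sE (short_exact_comp0 _ qp).
  exists (x, x2); rewrite iE /= rE; congr pair; apply/eqP; rewrite -subr_eq0.
  rewrite -!linearB; apply/eqP/qlc_ex; exists (- x1); rewrite /= lE.
  by congr (q _); congr pair; rewrite ?sub0r ?subrr.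
- by move=> z; have [y <-] := p_surj z; exists (c y, 0); rewrite /= sE.
Qed.

(** Dually, the kernel [C] of the composite from [P] to [M] is an extension of [M'] by [G], and the
    spare [M] turns the quotient [M'] into [M * M']. *)
Lemma summand_prev M M' : totally_resolved (M * M')%type ->
  exists C, totally_resolved (C * M)%type /\ step C M.
Proof.
move=> totMM'; have [G [totG stG]] := totally_resolved_prev totMM'.
have [P [q [p [projP qp q_ext]]]] := stG.
have [q_inj qp_ex p_surj] := qp.
have fstp_surj : surj (fst \o p).
  by move=> x; have [y yE] := p_surj (x, 0); exists y; rewrite /= yE.
have [C [c cp]] := short_exact_kernel fstp_surj; have [c_inj cp_ex _] := cp.
exists C; split; last first.
  exists P, c, (fst \o p : {linear P -> M}); split=> // N LN f.
  exact: (step_extends_summand stG cp LN).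
have [i iE] := linear_factors (f := q) c_inj (fun x => proj1 (cp_ex _) (congr1 fst (short_exact_comp0 x qp))).
have [i' i'E] := linear_pair i (\0 : {linear G -> M}).
have [s sE] := linear_pair (snd : {linear (C * M)%type -> M}) (snd \o p \o c \o fst).
apply: (totally_resolved_extension (f := i') (g := s) _ totG totMM').
split.
- apply: linear_inj0 => x; rewrite i'E => /(congr1 fst) /= ix.
  by apply: (injective_eq0 q_inj); rewrite -iE ix linear0.
- move=> [k m]; rewrite sE /=; split=> [[-> pk2]|[x]].
    have /qp_ex[x xE]: p (c k) = 0.
      by rewrite [LHS]surjective_pairing pk2; have /= -> := short_exact_comp0 k cp.
    by exists x; rewrite i'E; congr pair; apply: c_inj; rewrite iE.
  by rewrite i'E => -[<- <-]; rewrite iE (short_exact_comp0 _ qp).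
- move=> [m m']; have [y yE] := p_surj (0, m').
  have /cp_ex[k kE]: (fst \o p) y = 0 by rewrite /= yE.
  by exists (k, m); rewrite sE /= kE yE.
Qed.

(** Having a complement with totally resolved sum is an invariant property: the neighbours of [M]
    built above have [M] itself as complement. *)
Lemma totally_resolved_summand : summand_closed totally_resolved.
Proof.
move=> M M' N f f_bij totN.
exists (fun M => exists M' : lmodType R, totally_resolved (M * M')%type).
split; first by exists M'; exact: totally_resolved_iso f_bij totN.
move=> {M M' N f f_bij totN} M [M' totMM'].
have [C [totC stC]] := summand_next totMM'.
have [D [totD stD]] := summand_prev totMM'.
by split; [exists C|exists D]; split=> //; exists M.
Qed.

Lemma totally_resolved_epi_kernel : epi_kernel_closed totally_resolved.
Proof.
move=> A B C f g fg totB totC; have [f_inj fg_ex g_surj] := fg.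
have [K [totK [Q [u [v [projQ uv _]]]]]] := totally_resolved_prev totC.
have [u_inj uv_ex v_surj] := uv.
have [w wE] := projQ _ _ g v g_surj.
have [|k kE] := @linear_factors R _ _ _ f (w \o u) f_inj.
  by move=> x; apply/fg_ex; rewrite /= wE (short_exact_comp0 _ uv).
(* As [f \o k] equals [w \o u], the map [s] below kills exactly this antidiagonal copy of [K]. *)
have [i iE] := linear_pair (\- k) u.
have [s sE] := linear_copair f w.
have id_bij : bijective (idfun : {linear (A * Q)%type -> (A * Q)%type}).
  by exists idfun.
apply: (totally_resolved_summand id_bij).
apply: (totally_resolved_extension (f := i) (g := s) _ totK totB).
split.
- by apply: linear_inj0 => x; rewrite iE => /(congr1 snd)/(injective_eq0 u_inj).
- move=> [x y]; rewrite sE; split=> [fw0|[c]]; last first.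
    by rewrite iE => -[<- <-]; rewrite linearN kE addNr.
  have /uv_ex[c cy]: v y = 0.
    by rewrite -wE -[w y](addKr (f x)) fw0 addr0 linearN (short_exact_comp0 _ fg) oppr0.
  exists c; rewrite iE cy; congr pair; apply: f_inj; apply/eqP.
  by rewrite eq_sym linearN kE /= cy -addr_eq0 fw0.
- move=> b; have [y yb] := v_surj (g b).
  have /fg_ex[x xE]: g (b - w y) = 0 by rewrite linearB wE yb subrr.
  by exists (x, y); rewrite sE xE subrK.
Qed.

Lemma totally_resolved_left_thick : left_thick totally_resolved.
Proof.
split; [exact: totally_resolved_summand | exact: totally_resolved_extension |].
exact: totally_resolved_epi_kernel.
Qed.

End TotalResolutions.

(** * Complexes of projectives versus chains of steps *)

Section GorensteinProjective.
Variables (R : pzRingType) (L : modclass R).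
Implicit Types M N : lmodType R.

(** Consecutive kernels in the complex are joined by a step. A map on a kernel [M] pulls back to a
    cocycle on the preceding term, and Hom-exactness writes this cocycle as a map on [P i] after the
    differential. *)
Lemma complex_step (P : int -> lmodType R) (d : forall i, {linear P i -> P (i - 1)})
    (i : int) M M' (j : {linear M -> P i}) (j' : {linear M' -> P (i - 1)}) :
    (forall i, projective (P i)) -> (forall i, exact (d i) (d (i - 1))) ->
    (forall N, L N -> forall i (f : {linear P (i - 1) -> N}),
       (forall x, f (d i x) = 0) ->
       exists g : {linear P (i - 1 - 1) -> N}, forall x, f x = g (d (i - 1) x)) ->
    injective j -> exact j (d i) -> injective j' -> exact j' (d (i - 1)) ->
  step L M M'.
Proof.
move=> projP dd_ex d_ext j_inj j_ex j'_inj j'_ex.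
have [p pE] : exists p : {linear P i -> M'}, forall x, j' (p x) = d i x.
  by apply: linear_factors => // x; apply/j'_ex/dd_ex; exists x.
exists (P i), j, p; split=> //.
  split=> // [y|m'].
    split=> [py|/j_ex dy]; first by apply/j_ex; rewrite -pE py linear0.
    by apply: (injective_eq0 j'_inj); rewrite pE.
  have /dd_ex[x xE]: d (i - 1) (j' m') = 0 by apply/j'_ex; exists m'.
  by exists x; apply: j'_inj; rewrite pE.
move=> N LN f; clear p pE j' j'_inj j'_ex.
(* Hom-exactness at index [k] extends maps to [P (k - 1 - 1)]; substituting this form for [i] avoids
   transport between equal indices. *)
have [k ik] : exists k, i = k - 1 - 1 by exists (i + 1 + 1); rewrite !addrK.
subst i.
have [q qE] : exists q : {linear P (k - 1) -> M}, forall x, j (q x) = d (k - 1) x.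
  by apply: linear_factors => // x; apply/j_ex/dd_ex; exists x.
have [x|g gE] := d_ext N LN k (f \o q).
  have dd0 : d (k - 1) (d k x) = 0 by apply/dd_ex; exists x.
  have /= -> : q (d k x) = 0 by apply: (injective_eq0 j_inj); rewrite qE.
  exact: linear0.
exists g => m; have /dd_ex[x xE]: d (k - 1 - 1) (j m) = 0 by apply/j_ex; exists m.
have <- : q x = m by apply: j_inj; rewrite qE.
by rewrite qE -gE.
Qed.

(** All kernels of the differentials, up to isomorphism, form the invariant class. *)
Lemma gorenstein_totally_resolved M :
  gorenstein_projective L M -> totally_resolved L M.
Proof.
move=> [P [d [projP dd_ex d_ext [j [j_inj j_ex]]]]].
have {}d_ext N (LN : L N) i f := proj1 (d_ext N LN i f).
exists (fun M => exists i (j : {linear M -> P i}), injective j /\ exact j (d i)).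
split=> [|{M j j_inj j_ex} M [i [j [j_inj j_ex]]]]; first by exists (-1), j.
split.
  have [K [k [k_inj k_ex]]] := kernel_exists (d (i - 1)).
  exists K; split; first by exists (i - 1), k.
  exact: (complex_step projP dd_ex d_ext j_inj j_ex k_inj k_ex).
have [l il] : exists l, i = l - 1 by exists (i + 1); rewrite addrK.
subst i; have [K [k [k_inj k_ex]]] := kernel_exists (d l).
exists K; split; first by exists l, k.
exact: (complex_step projP dd_ex d_ext k_inj k_ex j_inj j_ex).
Qed.

Lemma bi_infinite_steps (M : lmodType R) : totally_resolved L M ->
  exists S : int -> lmodType R, S (-1) = M /\ forall i, step L (S i) (S (i - 1)).
Proof.
move=> totM; pose T := {M : lmodType R | totally_resolved L M}.
have [nx nxE] : {nx : T -> T & forall x, step L (sval x) (sval (nx x))}.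
  apply: (choice (P := fun x y : T => step L (sval x) (sval y))) => -[N totN].
  have [N' [totN' st]] := totally_resolved_next totN.
  by exists (exist _ N' totN').
have [pv pvE] : {pv : T -> T & forall x, step L (sval (pv x)) (sval x)}.
  apply: (choice (P := fun x y : T => step L (sval y) (sval x))) => -[N totN].
  have [N' [totN' st]] := totally_resolved_prev totN.
  by exists (exist _ N' totN').
pose x : T := exist _ M totM.
(* [Negz n] is [-(n + 1)], so index [-1] carries [M] itself and index [0] its first predecessor;
   hence the extra iteration on the nonnegative side. *)
exists (fun i => sval match i with
                      | Posz n => iter n.+1 pv x | Negz n => iter n nx x end).
split=> // -[[|n]|n].
- exact: pvE.
- have -> : Posz n.+1 - 1 = Posz n by rewrite -[n.+1]addn1 PoszD addrK.
  exact: pvE.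
- have -> : Negz n - 1 = Negz n.+1 by rewrite !NegzE -opprD -PoszD addn1.
  exact: nxE.
Qed.

Lemma totally_resolved_gorenstein M :
  totally_resolved L M -> gorenstein_projective L M.
Proof.
move=> /bi_infinite_steps[S [<- stS]].
pose P i := sval (cid (stS i)).
have PP i : exists (qp : {linear S i -> P i} * {linear P i -> S (i - 1)}),
    [/\ projective (P i), short_exact qp.1 qp.2 & extends L qp.1].
  by rewrite /P; case: cid => /= Q [q [p [? ? ?]]]; exists (q, p).
pose q i := (sval (cid (PP i))).1; pose p i := (sval (cid (PP i))).2.
have projP i : projective (P i) by case: (svalP (cid (PP i))).
have qp i : short_exact (q i) (p i) by case: (svalP (cid (PP i))).
have q_ext i : extends L (q i) by case: (svalP (cid (PP i))).
clearbody P q p.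
have q_inj i : injective (q i) by case: (qp i).
have d0 i x : q (i - 1) (p i x) = 0 <-> p i x = 0.
  by split=> [/(injective_eq0 (@q_inj _))|->]; rewrite ?linear0.
(* The short exact sequences are spliced: each differential passes through the module shared by two
   consecutive steps. *)
exists P, (fun i => q (i - 1) \o p i); split=> //.
- move=> i y; have [_ qp_ex p_surj] := qp (i - 1); rewrite /= d0; split.
    move=> /qp_ex[z <-]; case: (qp i) => _ _ /(_ z)[x <-]; by exists x.
  by move=> [x <-]; rewrite (short_exact_comp0 _ (qp _)).
- move=> N LN i f; split=> [f0|[g gE] x]; last first.
    by rewrite gE /= (short_exact_comp0 _ (qp _)) !linear0.
  have [_ qp_ex p_surj] := qp (i - 1).
  have [|h hE] := @linear_descends R _ _ _ (p (i - 1)) f p_surj.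
    move=> y /qp_ex[z <-]; case: (qp i) => _ _ /(_ z)[x <-]; exact: f0.
  have [g gE] := q_ext _ N LN h.
  by exists g => x; rewrite /= gE hE.
- exists (q (-1)); split=> // y; rewrite /= d0.
  by case: (qp (-1)) => _ qp_ex _; exact: qp_ex.
Qed.

Lemma gorenstein_totally_resolvedE M :
  gorenstein_projective L M <-> totally_resolved L M.
Proof.
by split; [exact: gorenstein_totally_resolved | exact: totally_resolved_gorenstein].
Qed.

End GorensteinProjective.

(** * Dimension shifting *)

Section ExtVanishing.
Variable R : pzRingType.

(** The hypothesis says that [X] is closed under syzygies and has vanishing first Ext into [W].
    Dropping the first term of a resolution of [M] leaves a resolution of its syzygy, which lowers
    the degree by one. *)
Lemma Ext_vanishing (X : modclass R) (W : lmodType R) :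
    (forall (K P M : lmodType R) (f : {linear K -> P}) (g : {linear P -> M}),
       short_exact f g -> projective P -> X M ->
       X K /\ forall a : {linear K -> W}, exists b : {linear P -> W},
                forall x, b (f x) = a x) ->
  forall M, X M -> forall j, (1 <= j)%N -> Ext_eq0 j M W.
Proof.
move=> X_step M XM [//|j] _; elim: j M XM => [|j IH] M XM P d e.
  move=> [projP e_surj d0_ex d_ex] a a0.
  have [K [k ke]] := short_exact_kernel e_surj; have [k_inj ke_ex _] := ke.
  have [_ K_ext] := X_step _ _ _ _ _ ke (projP 0%N) XM.
  have [|p pE] := @linear_factors R _ _ _ k (d 0%N) k_inj.
    by move=> x; apply/ke_ex/d0_ex; exists x.
  have [||b bE] := @linear_descends R _ _ _ p a.
  - move=> y; have /d0_ex[x xE]: e (k y) = 0 by rewrite (short_exact_comp0 _ ke).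
    by exists x; apply: k_inj; rewrite pE.
  - move=> x px; have /(d_ex 0%N)[y <-]: d 0%N x = 0 by rewrite -pE px linear0.
    exact: a0.
  have [g gE] := K_ext b; exists g => x.
  by rewrite -pE gE bE.
move=> [projP e_surj d0_ex d_ex] a a0.
have [K [k ke]] := short_exact_kernel e_surj; have [k_inj ke_ex _] := ke.
have [XK _] := X_step _ _ _ _ _ ke (projP 0%N) XM.
have [|p pE] := @linear_factors R _ _ _ k (d 0%N) k_inj.
  by move=> x; apply/ke_ex/d0_ex; exists x.
apply: (IH K XK (fun n => P n.+1) (fun n => d n.+1) p _ a a0).
split=> // [y|x].
  have /d0_ex[x xE]: e (k y) = 0 by rewrite (short_exact_comp0 _ ke).
  by exists x; apply: k_inj; rewrite pE.
split=> [px|/(d_ex 0%N) dx]; first by apply/(d_ex 0%N); rewrite -pE px linear0.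
by apply: (injective_eq0 k_inj); rewrite pE.
Qed.

End ExtVanishing.

(** * Retracts, direct summands and splittings *)

Section Retracts.
Variable R : pzRingType.
Implicit Types M N P K X : lmodType R.

(** The complement of [M] in [N] is the kernel of [r], with projection [x - i (r x)]. *)
Lemma summand_closed_retract (X : modclass R) M N
    (i : {linear M -> N}) (r : {linear N -> M}) :
  summand_closed X -> (forall x, r (i x) = x) -> X N -> X M.
Proof.
move=> X_summand ri XN; have [K [k [k_inj k_ex]]] := kernel_exists r.
have [|s sE] := @linear_factors R _ _ _ k (idfun \- (i \o r)) k_inj.
  by move=> x; apply/k_ex; rewrite linearB /= ri subrr.
have [f fE] := linear_pair r s.
apply: (X_summand _ _ _ f _ XN).
exists (fun x => i x.1 + k x.2) => [x|[x y]].
  by rewrite fE sE /= addrC subrK.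
have ky : r (k y) = 0 by apply/k_ex; exists y.
rewrite fE linearD ri ky addr0; congr pair.
by apply: k_inj; rewrite sE /= linearD ri ky addr0 addrC addKr.
Qed.

Lemma projective_retract M P (i : {linear M -> P}) (r : {linear P -> M}) :
  (forall x, r (i x) = x) -> projective P -> projective M.
Proof.
move=> ri projP A B g f g_surj; have [h hE] := projP A B g (f \o r) g_surj.
by exists (h \o i) => x; rewrite /= hE /= ri.
Qed.

Lemma projective_split N P (g : {linear N -> P}) :
  projective P -> surj g -> exists s : {linear P -> N}, forall x, g (s x) = x.
Proof. by move=> projP /(projP _ _ g (idfun : {linear P -> P})). Qed.

Lemma projective_summand_closed : summand_closed (@projective R).
Proof.
move=> M M' N f [f' fK f'K] projN; have [l lE] := linear_inl M M'.
have [|h hE] := @linear_factors R _ _ _ f l (can_inj fK).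
  by move=> x; exists (f' (l x)).
apply: (projective_retract (i := h) (r := fst \o f)) projN => x.
by rewrite /= hE lE.
Qed.

Lemma short_exact_retraction K P M (f : {linear K -> P}) (g : {linear P -> M}) :
    short_exact f g -> projective M ->
  exists r : {linear P -> K}, forall x, r (f x) = x.
Proof.
move=> fg projM; have [f_inj fg_ex g_surj] := fg.
have [s sE] := projective_split projM g_surj.
have [|r rE] := @linear_factors R _ _ _ f (idfun \- (s \o g)) f_inj.
  by move=> x; apply/fg_ex; rewrite linearB /= sE subrr.
exists r => x; apply: f_inj; rewrite rE /= (short_exact_comp0 _ fg).
by rewrite linear0 subr0.
Qed.

End Retracts.

(** * Free modules as coproducts of copies of the ring *)

Section FreeModules.
Variable R : pzRingType.

Lemma sum_uniq_subset (K : eqType) (V : zmodType) (F : K -> V) (s t : seq K) :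
    uniq s -> uniq t -> {subset s <= t} -> (forall k, k \notin s -> F k = 0) ->
  \sum_(k <- s) F k = \sum_(k <- t) F k.
Proof.
move=> s_uniq t_uniq st F0; rewrite [RHS](bigID (mem s)) /= [X in _ + X]big1 //.
rewrite addr0 -[RHS]big_filter; apply/perm_big/uniq_perm => //.
  exact: filter_uniq.
by move=> k; rewrite mem_filter; case: (boolP (k \in s)) => // /st ->.
Qed.

(** The model consists of the finitely supported functions on [K]. The induced map sums over a
    chosen support, and comparison over a common larger list makes it linear. *)
Lemma free_module_exists (K : choiceType) :
  exists (F : lmodType R) (e : K -> {linear R^o -> F}),
    is_coproduct (M := fun=> R^o) e.
Proof.
pose fin_supp (x : K -> R^o) := exists s : seq K, forall k, k \notin s -> x k = 0.
have [||F [j [j_inj jE]]] := @submodule_exists R (K -> R^o) fin_supp.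
- by exists [::].
- move=> a x y [s xs] [t yt]; exists (s ++ t) => k; rewrite mem_cat negb_or.
  move=> /andP[/xs xk /yt yk].
  by rewrite [LHS](_ : _ = a *: x k + y k) // xk yk scaler0 addr0.
have [e eE] : {e : K -> {linear R^o -> F} &
    forall k r, j (e k r) = fun k' => if k' == k then r else 0}.
  apply: (choice (P := fun k (e : {linear R^o -> F}) =>
    forall r, j (e r) = fun k' => if k' == k then r else 0)) => k.
  have [|d dE] := @linear_exists R R^o (K -> R^o)
      (fun r k' => if k' == k then r else 0).
    move=> a x y; apply/funext => k'.
    rewrite [RHS](_ : _ = a *: (if k' == k then x else 0) +
                          if k' == k then y else 0) //.
    by case: ifP => // _; rewrite scaler0 addr0.
  have [|h hE] := @linear_factors R _ _ _ j d j_inj.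
    move=> r; apply/jE; exists [:: k] => k'; rewrite inE dE.
    by move=> /negbTE ->.
  by exists h => r; rewrite hE dE.
have [s sE] : {s : F -> seq K & forall x, uniq (s x) /\
    forall k, k \notin s x -> j x k = 0}.
  apply: (choice (P := fun x s => uniq s /\ forall k, k \notin s -> j x k = 0)) => x.
  have /jE[s xs] : exists y, j y = j x by exists x.
  exists (undup s); rewrite undup_uniq; split=> // k; rewrite mem_undup.
  exact: xs.
exists F, e => N f.
pose h x := \sum_(k <- s x) f k (j x k).
have hE x t : uniq t -> {subset s x <= t} -> h x = \sum_(k <- t) f k (j x k).
  have [s_uniq s0] := sE x; move=> t_uniq st; apply: sum_uniq_subset => //.
  by move=> k /s0 ->; rewrite linear0.
have [|l lE] := @linear_exists R F N h.
  move=> a x y; pose t := undup (s (a *: x + y) ++ s x ++ s y).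
  have t_uniq : uniq t by exact: undup_uniq.
  rewrite (hE _ t) // => [|k]; last by rewrite mem_undup mem_cat => ->.
  rewrite (hE x t) // => [|k]; last first.
    by rewrite mem_undup !mem_cat => ->; rewrite orbT.
  rewrite (hE y t) // => [|k]; last first.
    by rewrite mem_undup !mem_cat => ->; rewrite !orbT.
  rewrite scaler_sumr -big_split /=; apply: eq_bigr => k _.
  by rewrite -linearP linearP.
have xE x : x = \sum_(k <- s x) e k (j x k).
  have [s_uniq s0] := sE x; apply: j_inj; rewrite linear_sum.
  apply/funext => k; rewrite fct_sumE; case: (boolP (k \in s x)) => [ks|/[dup] ks /s0 ->].
    rewrite (bigD1_seq k) //= eE eqxx big1 ?addr0 // => k' k'k.
    by rewrite eE eq_sym (negbTE k'k).
  rewrite big_seq big1 // => k' k's; rewrite eE; case: eqP => // kk'.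
  by rewrite kk' k's in ks.
exists l; split=> [k r|h' h'E x].
  rewrite lE; have [_ s0] := sE (e k r).
  have [rs|] := boolP (k \in s (e k r)).
    rewrite (hE _ (s (e k r))) //; last by case: (sE (e k r)).
    rewrite /= (bigD1_seq k) //=; last by case: (sE (e k r)).
    rewrite eE eqxx big1 ?addr0 // => k' k'k.
    by rewrite (negbTE k'k) linear0.
  (* A chosen support that misses [k] forces [r = 0]. *)
  move=> /s0; rewrite {1}eE eqxx => ->; rewrite (linear0 (f k)).
  by rewrite /h big1 // => k' _; rewrite eE; case: ifP => _; rewrite linear0.
rewrite lE /h [in LHS](xE x) linear_sum; apply: eq_bigr => k _.
exact: h'E.
Qed.

(** The basis is [M] itself, each basis element being sent to the element that indexes it. *)
Lemma free_cover (M : lmodType R) :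
  exists (F : lmodType R) (e : M -> {linear R^o -> F}) (p : {linear F -> M}),
    is_coproduct (M := fun=> R^o) e /\ surj p.
Proof.
have [F [e e_coprod]] := free_module_exists M.
have f_exists (m : M) : exists f : {linear R^o -> M}, forall r, f r = (r : R) *: m.
  apply: (@linear_exists R R^o M (fun r : R => r *: m)) => a x y.
  by rewrite /= scalerDl scalerA.
have [p [pE _]] := e_coprod M (fun m => sval (cid (f_exists m))).
exists F, e, p; split=> // m; exists (e m 1); rewrite pE.
by case: cid => f /= ->; rewrite scale1r.
Qed.

Lemma projective_class (X : modclass R) (M : lmodType R) :
  X R^o -> coproduct_closed X -> summand_closed X -> projective M -> X M.
Proof.
move=> XR X_coprod X_summand projM.
have [F [e [p [e_coprod p_surj]]]] := free_cover M.
have [s ps] := projective_split projM p_surj.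
exact: (summand_closed_retract X_summand ps (X_coprod _ _ _ _ e_coprod (fun=> XR))).
Qed.

End FreeModules.

(** * The Frobenius conditions for Gorenstein projectives *)

Section GorensteinFrobenius.
Variables (R : pzRingType) (L : modclass R).

Lemma frobenius_projective M :
  left_frobenius_pair (gorenstein_projective L) L -> L M -> projective M.
Proof.
move=> [_ _ [LG _] _] LM; have /gorenstein_totally_resolved := LG _ LM.
move=> /totally_resolved_next[M' [_ [P [q [p [projP _ q_ext]]]]]].
have [r rq] := q_ext M LM (idfun : {linear M -> M}).
exact: projective_retract rq projP.
Qed.

Hypothesis LP : forall M, L M <-> projective M.

Let projL M : projective M -> L M. Proof. by move/LP. Qed.

Let GP : modclass R := gorenstein_projective L.

Let GPE : GP = totally_resolved L.
Proof. by apply/funext => M; apply/propext/gorenstein_totally_resolvedE. Qed.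

Let LE : L = @projective R.
Proof. by apply/funext => M; apply/propext/LP. Qed.

(** Syzygies stay in the class because it is closed under kernels of epimorphisms, and the step
    ending at [M] kills the first Ext. *)
Lemma gorenstein_injective_wrt : injective_wrt GP L.
Proof.
rewrite GPE => M N totM LN; apply: Ext_vanishing totM => K P {}M f g fg projP totM.
split.
  apply: (totally_resolved_epi_kernel projL fg) => //.
  exact: totally_resolved_projective.
have [K' [_ st]] := totally_resolved_prev totM.
exact: (step_extends st fg LN).
Qed.

Lemma gorenstein_projective_wrt : projective_wrt GP L.
Proof.
rewrite LE => M N _ projN; apply: Ext_vanishing projN => K P N' f g fg projP projN'.
have [r rf] := short_exact_retraction fg projN'.
split; first exact: projective_retract rf projP.
by move=> a; exists (a \o r) => x; rewrite /= rf.
Qed.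

Lemma gorenstein_strong_left_frobenius : strong_left_frobenius_pair GP L.
Proof.
have LGP M : L M -> GP M.
  by rewrite GPE => /LP; exact: totally_resolved_projective.
split; [split| |].
- by rewrite GPE; exact: totally_resolved_left_thick.
- exact: gorenstein_injective_wrt.
- split=> // M; rewrite GPE => /totally_resolved_next[M' [totM' [P [q [p [projP qp _]]]]]].
  by exists P, M', q, p; split=> //; apply/LP.
- by rewrite LE; exact: projective_summand_closed.
- exact: gorenstein_projective_wrt.
- split=> // M; rewrite GPE => /totally_resolved_prev[M' [totM' [P [q [p [projP qp _]]]]]].
  by exists P, M', q, p; split=> //; apply/LP.
Qed.

End GorensteinFrobenius.

(** * Injectivity of Q/Z among abelian groups *)

Section InjectivityOfQmodZ.

Lemma additive_exists (U V : zmodType) (f : U -> V) :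
  {morph f : x y / x - y} -> exists g : {additive U -> V}, g =1 f.
Proof.
move=> fB; pose addM := GRing.isZmodMorphism.Build U V f fB.
pose g : {additive U -> V} := HB.pack f addM.
by exists g.
Qed.

Lemma QmodZ_divisible (y : QmodZ) (n : nat) : (0 < n)%N ->
  exists x : QmodZ, x *+ n = y.
Proof.
move=> n_gt0; exists (\pi_{ideal_quot ratZ} (repr y / n%:R)).
rewrite -raddfMn /= -(mulr_natr (_ / _)) divfK ?reprK //.
by rewrite Num.Theory.pnatr_eq0 -lt0n.
Qed.

(** These are the graphs of homomorphisms from subgroups of [V] to [QmodZ]; as sets they are ordered
    by inclusion, as Zorn's lemma needs. *)
Definition graph_like (V : zmodType) (A : set (V * QmodZ)) : Prop :=
  [/\ A (0, 0), forall a b, A a -> A b -> A (a - b)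
    & forall y, A (0, y) -> y = 0].

Lemma graph_like_mulz (V : zmodType) (A : set (V * QmodZ)) a (n : int) :
  graph_like A -> A a -> A (a.1 *~ n, a.2 *~ n).
Proof.
move=> [A0 AB _] Aa.
have AN b : A b -> A (- b) by move=> Ab; rewrite -sub0r; apply: AB.
have AMn k : A (a.1 *+ k, a.2 *+ k).
  elim: k => [|k IH] //; rewrite !mulrSr.
  by have := AB _ _ IH (AN _ Aa); rewrite opprK.
case: n => k; first exact: AMn.
by rewrite NegzE !mulrNz; apply: (AN (_, _)); apply: AMn.
Qed.

(* The value at v only has to be compatible with the relation n v = w of
   least positive n, if there is one; divisibility solves n t = y. *)
Lemma graph_like_slope (V : zmodType) (A : set (V * QmodZ)) (v : V) :
  graph_like A ->
  exists t : QmodZ, forall (n : int) y, A (v *~ n, y) -> y = t *~ n.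
Proof.
move=> graphA; have [A0 AB Afun] := graphA.
have Auniq w y y' : A (w, y) -> A (w, y') -> y = y'.
  move=> Ay /(AB _ _ Ay) /= Ayy'; apply/eqP; rewrite -subr_eq0; apply/eqP/Afun.
  by rewrite -(subrr w).
pose D : pred nat := fun n => (0 < n)%N && `[< exists y, A (v *+ n, y) >].
have [exD|noD] := pselect (exists n, D n); last first.
  exists 0; move=> n y Any; rewrite mul0rz.
  have ninv : ~ exists k, (0 < k)%N /\ exists z, A (v *+ k, z).
    by move=> [k [k0 Ak]]; apply: noD; exists k; rewrite /D k0; apply/asboolP.
  case: n Any => [[|n]|n] Any; first exact: Afun.
    by case: ninv; exists n.+1; split=> //; exists y.
  case: ninv; exists n.+1; split=> //; exists (- y).
  by have := graph_like_mulz (-1) graphA Any; rewrite /= !mulrN1z NegzE mulrNz opprK.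
have [n /andP[n_gt0 /asboolP[y An]] n_min] := ex_minnP exD.
have [t tE] := QmodZ_divisible y n_gt0.
exists t => k z Akz.
have n_neq0 : Posz n != 0 by rewrite -lt0n.
have kE := divz_eq k n.
set q := (k %/ n)%Z in kE; set r := (k %% n)%Z in kE.
have Ar : A (v *~ r, z - y *~ q).
  have := AB _ _ Akz (graph_like_mulz q graphA An); rewrite /=.
  congr A; congr pair.
  by rewrite pmulrn -mulrzA [in LHS]kE mulrzDr mulrC addrC addKr.
have r_ge0 : 0 <= r := modz_ge0 k n_neq0.
have r_ltn : r < n by apply: ltz_pmod.
(* A nonzero remainder would be a positive relation smaller than the minimal [n]. *)
have r0 : r = 0.
  case: (r) r_ge0 r_ltn Ar => // -[//|m] _; rewrite ltz_nat => mn Am.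
  have /n_min: D m.+1 by apply/andP; split=> //; apply/asboolP; exists (z - y *~ q).
  by rewrite leqNgt mn.
have /eqP := Afun _ (eq_ind r (fun r => A (v *~ r, _)) Ar 0 r0).
rewrite subr_eq0 => /eqP ->; rewrite kE r0 addr0 -tE pmulrn -mulrzA mulrC.
by [].
Qed.

(** Baer's argument: a maximal graph containing all pairs [(i u, f u)] is defined on the whole of
    [V]. *)
Lemma QmodZ_injective (U V : zmodType) (i : {additive U -> V})
    (f : {additive U -> QmodZ}) :
  injective i -> exists g : {additive V -> QmodZ}, forall u, g (i u) = f u.
Proof.
move=> i_inj.
pose good (A : set (V * QmodZ)) := graph_like A /\ forall u, A (i u, f u).
have [F FP F_tot|A [PA A_max]] :=
    (* The union of the empty chain is empty and so not [good]; the nonemptiness premise admits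
       it. *)
    @Zorn_bigcup (V * QmodZ)%type [set A | (exists a, A a) -> good A]%classic.
  move=> [a [X FX Xa]].
  have goodF Y b : F Y -> Y b -> good Y by move=> /FP + Yb; apply; exists b.
  have [[X0 XB Xfun] Xf] := goodF X a FX Xa.
  split; last by move=> u; exists X.
  split; first by exists X.
    move=> b c [Y FY Yb] [Z FZ Zc].
    have [[_ YB _] _] := goodF Y b FY Yb; have [[_ ZB _] _] := goodF Z c FZ Zc.
    have [YZ|ZY] := F_tot Y Z FY FZ; [exists Z | exists Y] => //.
      by apply: ZB => //; apply: YZ.
    by apply: YB => //; apply: ZY.
  move=> y [Y FY Yy]; have [[_ _ Yfun] _] := goodF Y _ FY Yy.
  exact: Yfun.
have /PA[graphA Af] : exists a, A a.
  apply: contrapT => A0.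
  apply: (A_max [set a | exists u, a = (i u, f u)]%classic).
    split=> [a Aa|sub]; first by case: A0; exists a.
    by apply: A0; exists (i 0, f 0); apply: sub; exists 0.
  move=> _; split; last by move=> u; exists u.
  split; first by exists 0; rewrite !raddf0.
    by move=> _ _ [u ->] [u' ->]; exists (u - u'); rewrite !raddfB.
  move=> y [u [iu ->]]; suff -> : u = 0 by rewrite raddf0.
  by apply: i_inj; rewrite raddf0.
have [A0 AB Afun] := graphA.
have /choice[g gA] v : exists y, A (v, y).
  have [t tE] := graph_like_slope v graphA; apply: contrapT => nov.
  (* This is the subgroup generated by [A] and [(v, t)]; the slope [t] keeps it a graph. *)
  apply: (A_max [set a | exists n : int, A (a.1 - v *~ n, a.2 - t *~ n)]%classic).
    split=> [a Aa|sub]; first by exists 0; rewrite !mulr0z !subr0 -surjective_pairing.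
    by apply: nov; exists t; apply: sub; exists 1; rewrite /= !mulr1z !subrr.
  move=> _; split; last by move=> u; exists 0; rewrite /= !mulr0z !subr0; exact: Af.
  split; first by exists 0; rewrite !mulr0z !subr0.
    move=> a b [n An] [m Am]; exists (n - m).
    have swap (W : zmodType) (x y z : W) :
      (x - z *~ n) - (y - z *~ m) = (x - y) - z *~ (n - m).
      by rewrite mulrzBr !opprB addrACA [RHS]addrACA [- y + _]addrC.
    by have := AB _ _ An Am; rewrite /= -!swap.
  move=> y [n /=]; rewrite sub0r -mulrNz => /tE/eqP.
  by rewrite mulrNz subr_eq addNr => /eqP.
have gE v y : A (v, y) -> g v = y.
  move=> Ay; apply/eqP; rewrite -subr_eq0; apply/eqP/Afun.
  by rewrite -(subrr v); apply: (AB _ _ (gA v) Ay).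
have [|h hE] := @additive_exists V QmodZ g.
  by move=> v w; apply: gE; apply: (AB _ _ (gA v) (gA w)).
by exists h => u; rewrite hE; apply: gE.
Qed.

End InjectivityOfQmodZ.

(** * Tensor products and characters *)

Section TensorProduct.
Variables (R : pzRingType).

(** One direction of the tensor-Hom adjunction. The map is defined on the free abelian group, with
    [QmodZ] seen as a module over the integers, and vanishes on the relators. *)
Lemma tensor_lift (A : lmodType R^c) (M : lmodType R)
    (u : {linear A -> (char_left M : lmodType R^c)}) :
  exists t : {additive tensor A M -> QmodZ}, forall a m, t (tens a m) = u a m.
Proof.
pose F := {freeg (A * M)%type}.
pose phi (x : F) : QmodZ := fglift (fun am => u am.1 am.2 : zmodule QmodZ) x.
have phiB x y : phi (x - y) = phi x - phi y.
  exact: (@lift_is_additive int _ (zmodule QmodZ) (fun am => u am.1 am.2) x y).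
have phi0 : phi 0 = 0 by rewrite -(subrr (0 : F)) phiB subrr.
have phiD x y : phi (x + y) = phi x + phi y.
  by rewrite -[y in LHS]opprK phiB -[- y]sub0r phiB phi0 sub0r opprK.
have phiU a m : phi << (a, m) >> = u a m by rewrite /phi liftU scale1r.
have phi_rel x : tensor_rel x -> phi x = 0.
  elim=> {x} [a a' m|a m m'|r a m||x y _ x0 _ y0]; rewrite ?phiB ?phiD ?phiU.
  - by rewrite linearD subrr.
  - by rewrite raddfD subrr.
  - by rewrite linearZ subrr.
  - exact: phi0.
  - by rewrite x0 y0 subrr.
have phi_pi x y : \pi_{ideal_quot tensor_sub A M} x = \pi y :> tensor A M -> phi x = phi y.
  move=> /tens_eqP/phi_rel/eqP; rewrite phiB subr_eq0 => /eqP //.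
have [|t tE] := @additive_exists (tensor A M) QmodZ (phi \o repr).
  by move=> x y /=; rewrite -phiB; apply: phi_pi; rewrite raddfB /= !reprK.
by exists t => a m; rewrite tE /= -phiU; apply: phi_pi; rewrite reprK.
Qed.

Lemma tensDl (A : lmodType R^c) (M : lmodType R) (a a' : A) (m : M) :
  tens (a + a') m = tens a m + tens a' m.
Proof. by rewrite /tens -raddfD; apply/tens_eqP/TensorDl. Qed.

Lemma tensBr (A : lmodType R^c) (M : lmodType R) (a : A) (m m' : M) :
  tens a (m - m') = tens a m - tens a m'.
Proof.
have tD x y : tens a (x + y) = tens a x + tens a y.
  by rewrite /tens -raddfD; apply/tens_eqP/TensorDr.
by rewrite -[m in RHS](subrK m') [tens a (_ + m')]tD addrK.
Qed.

Lemma tensZ (A : lmodType R^c) (M : lmodType R) (r : R) (a : A) (m : M) :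
  tens ((r : R^c) *: a) m = tens a (r *: m).
Proof. exact/tens_eqP/TensorZ. Qed.

Lemma tens_eq0 (A : lmodType R^c) (M : lmodType R) (m : M) : tens (0 : A) m = 0.
Proof.
by apply: (addrI (tens (0 : A) m)); rewrite -tensDl !addr0. Qed.

Lemma tensor_map0 (A B : lmodType R^c) (M : lmodType R) (x : tensor A M) :
  tensor_map (\0 : {linear A -> B}) x = 0.
Proof.
have [t tE] := additive_exists (tensor_map_is_additive (M := M) (\0 : {linear A -> B})).
rewrite -tE -[x]reprK -{1}[repr x]freeg_sumE !raddf_sum big1 // => -[a m] _ /=.
have -> : << coeff (a, m) (repr x) *g (a, m) >> =
    << (a, m) >> *~ coeff (a, m) (repr x) :> {freeg (A * M)%type}.
  by rewrite freegU_mulz intz.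
by rewrite !raddfMz /= tE tensor_mapE tens_eq0 mul0rz.
Qed.

(** Flatness is phrased for exact pairs, so injectivity of [f] enters as exactness of the zero map
    followed by [f]. *)
Lemma flat_tensor_map_injective (A B : lmodType R^c) (M : lmodType R)
    (f : {linear A -> B}) :
  flat M -> injective f -> forall x y : tensor A M, tensor_map f x = tensor_map f y -> x = y.
Proof.
move=> M_flat f_inj x y fxy.
have f_ex : exact (\0 : {linear A -> A}) f.
  move=> a; split=> [/(injective_eq0 f_inj) ->|[x' <-]]; last exact: linear0.
  by exists 0.
have /(M_flat _ _ _ _ _ f_ex)[z] : tensor_map f (x - y) = 0.
  by rewrite tensor_map_is_additive fxy subrr.
by rewrite tensor_map0 => /esym/eqP; rewrite subr_eq0 => /eqP.
Qed.

(* Hom(-, M^+) is the character functor composed with - \otimes M. *)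
Lemma flat_char_injective (A B : lmodType R^c) (M : lmodType R)
    (f : {linear A -> B}) (u : {linear A -> (char_left M : lmodType R^c)}) :
  flat M -> injective f ->
  exists v : {linear B -> (char_left M : lmodType R^c)}, forall a, v (f a) = u a.
Proof.
move=> M_flat f_inj; have [t tE] := tensor_lift u.
have [i iE] := additive_exists (tensor_map_is_additive (M := M) f).
have [|s sE] := QmodZ_injective (i := i) t.
  by move=> x y; rewrite !iE; exact: flat_tensor_map_injective.
have v_exists b : exists vb : char_left M, forall m, vb m = s (tens b m).
  apply: additive_exists (fun m => s (tens b m)) _ => m m'.
  by rewrite tensBr raddfB.
have /choice[v vE] := v_exists.
have [|w wE] := @linear_exists R^c B (char_left M : lmodType R^c) v.
  move=> r b b'; apply: additive_ext => m /=.
  by rewrite !vE tensDl tensZ raddfD.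
by exists w => a; apply: additive_ext => m; rewrite wE vE -tensor_mapE -iE sE tE.
Qed.

End TensorProduct.

(** * Flat modules belong to the left class of a perfect duality pair *)

Section CharacterDuality.
Variables (R : pzRingType) (L : modclass R) (A : modclass R^c).

Lemma flat_in_duality_class (M : lmodType R) :
  perfect_duality_pair L A -> flat M -> L M.
Proof.
move=> [[LA A_summand _] LR L_coprod _] M_flat.
have [F [e [p [e_coprod p_surj]]]] := free_cover M.
have LF : L F := L_coprod _ _ _ _ e_coprod (fun=> LR).
have [|i iE] := @linear_exists R^c (char_left M : lmodType R^c)
    (char_left F : lmodType R^c) (fun phi => (phi \o p : {additive F -> QmodZ})).
  by move=> r phi psi; apply: additive_ext => x /=; rewrite linearZ.
have i_inj : injective i.
  move=> phi psi ipq; apply: additive_ext => m; have [x <-] := p_surj m.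
  have := congr1 (fun h : char_left F => h x) ipq.
  by rewrite !iE.
(* Extending the identity along [i], the dual of [p], makes the character module of [M] a retract of
   that of [F]. *)
have [r ri] := flat_char_injective
  (idfun : {linear (char_left M : lmodType R^c) -> (char_left M : lmodType R^c)})
  M_flat i_inj.
by apply/LA; apply: (summand_closed_retract A_summand ri); apply/LA.
Qed.

End CharacterDuality.

Theorem proposition3p11 (R : pzRingType) (L : modclass R) (A : modclass R^c)
    (isoL : iso_closed L) (isoA : iso_closed A)
    (dual : complete_duality_pair L A) :
  [/\ strong_left_frobenius_pair (gorenstein_projective L) L <->
        left_frobenius_pair (gorenstein_projective L) L,
      left_frobenius_pair (gorenstein_projective L) L <->
        (forall M : lmodType R, L M <-> projective M)
    & (forall M : lmodType R, L M <-> projective M) -> left_perfect R].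
Proof.
(* Closure of [L] under summands comes from the reversed duality pair. *)
have [perfectLA [_ L_summand _]] := dual.
have [_ LR L_coprod _] := perfectLA.
have frob_LP : left_frobenius_pair (gorenstein_projective L) L ->
    forall M : lmodType R, L M <-> projective M.
  move=> frob M; split; first exact: frobenius_projective.
  exact: projective_class.
have LP_strong (LP : forall M : lmodType R, L M <-> projective M) :=
  gorenstein_strong_left_frobenius LP.
split.
- by split=> [[]|/frob_LP/LP_strong].
- by split=> [|/LP_strong[]].
- by move=> LP M /(flat_in_duality_class perfectLA)/LP.
Qed.
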